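(* There exists a constant $c>0$ such that the following holds. Let $n,d,m,N$ be positive integers. Let $G$ be an algebraic graph of complexity $(n,d,m)$ on $N$ vertices. Then $G$ contains either a clique or an independent set of size at least $c'N^{1/\gamma}$, where $c'=c'(n,d,m)>0$ and $$\gamma=c\,n\,m\,\min\left\{d,\frac{n\log d}{\log n}\right\}.$$
   Context: For a set $V$, $V^{(s)}$ denotes the family of $s$-element subsets of $V$. A graph $G$ is algebraic of complexity $(n,d,m)$ if its vertex set $V(G)$ is a subset of $\mathbb{F}^n$, where $\mathbb{F}$ is some field, and there exist $m$ polynomials $f_1,\dots,f_m:(\mathbb{F}^n)^2\to\mathbb{F}$ of degree at most $d$ and a Boolean formula $\phi:\{\text{false},\text{true}\}^m\to\{\text{false},\text{true}\}$ such that $\{\mathbf{v}_1,\mathbf{v}_2\}\in V(G)^{(2)}$ is an edge if and only if $\phi([f_1(\mathbf{v}_1,\mathbf{v}_2)=0],\dots,[f_m(\mathbf{v}_1,\mathbf{v}_2)=0])=\text{true}$. It is assumed that for $\{\mathbf{v}_1,\mathbf{v}_2\}\in V(G)^{(2)}$ the left-hand side is invariant under swapping $\mathbf{v}_1$ and $\mathbf{v}_2$, so the edges are well defined.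
   Formalization: Where the formula for γ is undefined (n = 1, where log n = 0, or d = 1, where γ would be 0 or 0/0 and 1/γ has no meaning), the minimum min{d, n log d / log n} is read as d. *)

(* Defs.v *)
From HB Require Import structures.
From mathcomp Require Import all_boot all_order all_algebra finmap.
From mathcomp Require Import mpoly.
From mathcomp Require Import reals exp.
Set Implicit Arguments. Unset Strict Implicit. Unset Printing Implicit Defensive.
Import Order.TTheory GRing.Theory Num.Theory.
Local Open Scope ring_scope.

(* [adj] is meaningful only on [vset]; its values elsewhere are never used. *)
Record graph (T : choiceType) := Graph {
  vset : {fset T};
  adj : rel T;
  adj_sym : {in vset &, forall x y, adj x y = adj y x};
  adj_irr : {in vset, irreflexive adj} }.

Definition clique (T : choiceType) (G : graph T) (S : {fset T}) : Prop :=
  (S `<=` vset G)%fset /\ {in S &, forall x y, x != y -> adj G x y}.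

Definition independent (T : choiceType) (G : graph T) (S : {fset T}) : Prop :=
  (S `<=` vset G)%fset /\ {in S &, forall x y, x != y -> ~~ adj G x y}.

(* The value at (v, w) of a polynomial in n + n variables: the first n
   variables are the coordinates of v, the last n those of w. *)
Definition eval2 (F : fieldType) (n : nat) (f : {mpoly F[n + n]})
    (v w : 'rV[F]_n) : F :=
  f.@[fun k => row_mx v w ord0 k].

(* [msize f <= d.+1] says that the total degree of f is at most d.  The
   symmetry of the right-hand side in v and w on distinct vertices follows
   from [adj_sym]. *)
Definition algebraic_graph (F : fieldType) (n d m : nat)
    (G : graph 'rV[F]_n) : Prop :=
  exists (f : 'I_m -> {mpoly F[n + n]}) (phi : {ffun 'I_m -> bool} -> bool),
    (forall i, (msize (f i) <= d.+1)%N) /\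
    {in vset G &, forall v w, v != w ->
      adj G v w = phi [ffun i => eval2 (f i) v w == 0]}.

(* min {d, n log d / log n}.  When n = 1 the second term has denominator
   log 1 = 0 and is read as +oo, so the minimum is d.  When d = 1 the formula
   would give gamma = 0 (or 0 / 0), for which the exponent 1 / gamma is
   undefined; the minimum is then read as d = 1 as well. *)
Definition min_factor (R : realType) (n d : nat) : R :=
  if (1 < n)%N && (1 < d)%N
  then Num.min d%:R (n%:R * ln d%:R / ln n%:R)
  else d%:R.

Definition gamma (R : realType) (c : R) (n d m : nat) : R :=
  c * n%:R * m%:R * min_factor R n d.

(* Main.v *)
Require Import Defs.
From HB Require Import structures.
From mathcomp Require Import all_boot all_order all_algebra finmap.
From mathcomp Require Import mpoly zify ring lra.
From mathcomp Require Import boolp reals exp.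
Set Implicit Arguments. Unset Strict Implicit. Unset Printing Implicit Defensive.
Import Order.TTheory GRing.Theory Num.Theory.
Local Open Scope ring_scope.

(** A stronger bound than required holds: a clique or an
independent set of size at least a constant times $N^{1/(n+2)}$ exists.
The denominator [gamma c n d m] is at least [n + 2] once [c = 3 / ln 2], because
[min_factor] is at least [ln 2] (lemma [gamma_ge]), so this is enough.

For a vertex x let h_(x,i) be the polynomial f_i(x, .) in n variables.  Over an
algebraically closed field one would choose an irreducible variety W of least
possible dimension k, of bounded degree, that holds at least about N / t^(n-k)
of the vertices.  If some h_(x,i) vanished on a fraction 1/t of the vertices in
W without vanishing on W, a component of W cut by h_(x,i) = 0 would be a better
choice.  So in W every h_(x,i) vanishes everywhere or on fewer than a fraction
1/t of the vertices ([dichotomous]).  By pigeonhole a constant proportion B of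
the vertices x in W agree on the set tau of those i for which h_(x,i) vanishes
identically on W.  For x in B all but few y in B satisfy
[f_i(x, y) = 0] exactly for i in tau; the exceptions form a digraph of out-degree
O(|B| / t), which has an independent set of size of order t.  There every ordered
pair of distinct vertices has the pattern tau, so the set is a clique or an
independent set, according to phi(tau).

Varieties are replaced by finite sets of points and linear algebra, so that
neither an algebraic closure nor a theory of dimension and degree is involved.
A set P is prime up to degree s when a product of two polynomials of degree at
most s vanishes on P only if one of the factors does ([prime_upto]).  When this
fails, passing to the zeros of a factor halves P at worst and enlarges the space of polynomials
of degree at most s that vanish on P, so every set has a prime subset of
comparable size ([prime_refinement]).

The dimension bound becomes a counting argument.  Consider sets
P_0 > P_1 > ... > P_l, nonempty and all prime up to degree s, and polynomials h_1, ..., h_l of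
degree at most d such that h_j vanishes on P_j but not on P_(j-1).  Then the
e^l products of powers of the h_j with exponents below e are linearly independent
as functions on P_0, provided s is large ([indep_cons]).  They lie in a space of
polynomials of degree at most d e l, of dimension at most (d e l + 1)^n, which is
impossible for l = n + 1 and e large ([lincomb_dependent]).  Hence the shrinking of
sets stops within n + 1 steps, each costing a factor O(t) ([exists_dichotomous]);
as at least about t points must be left, this gives the exponent n + 2. *)

(** * Polynomials of bounded degree *)

Section Degree.
Variables (F : fieldType) (n : nat).
Implicit Types (p q : {mpoly F[n]}).

Definition deg_le (k : nat) p := (msize p <= k.+1)%N.

Lemma deg_leW k l p : (k <= l)%N -> deg_le k p -> deg_le l p.
Proof. by rewrite /deg_le => kl /leq_trans; apply. Qed.

Lemma deg_leM k l p q : deg_le k p -> deg_le l q -> deg_le (k + l) (p * q).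
Proof.
rewrite /deg_le; have [->|p0] := eqVneq p 0; first by rewrite mul0r msize0.
have [->|q0] := eqVneq q 0; first by rewrite mulr0 msize0.
by rewrite msizeM //; move: (msize p) (msize q) => a b ? ?; lia.
Qed.

Lemma deg_le1 k : deg_le k 1.
Proof. by rewrite /deg_le msize1. Qed.

Lemma deg_leX k j p : deg_le k p -> deg_le (k * j) (p ^+ j).
Proof.
move=> pk; elim: j => [|j IH]; first exact: deg_le1.
by rewrite exprS mulnS; apply: deg_leM.
Qed.

Lemma deg_leZ k c p : deg_le k p -> deg_le k (c *: p).
Proof. by apply: leq_trans; apply: msizeZ_le. Qed.

Lemma deg_le_sum k (I : Type) (r : seq I) (P : pred I) (E : I -> {mpoly F[n]}) :
  (forall i, P i -> deg_le k (E i)) -> deg_le k (\sum_(i <- r | P i) E i).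
Proof.
move=> Ek; elim/big_ind: _ => [|p q pk qk|//]; first by rewrite /deg_le msize0.
by apply: leq_trans (msizeD_le _ _) _; rewrite geq_max; apply/andP.
Qed.

Lemma deg_le_prod (I : finType) (E : I -> {mpoly F[n]}) (k : I -> nat) :
  (forall i, deg_le (k i) (E i)) -> deg_le (\sum_i k i) (\prod_i E i).
Proof.
move=> Ek; elim/big_ind2: _ => [|a p b q|i _]; first exact: deg_le1.
  exact: deg_leM.
exact: Ek.
Qed.

Lemma deg_le_comp (k : nat) (p : {mpoly F[k]}) (lq : k.-tuple {mpoly F[n]}) d :
  (msize p <= d.+1)%N -> (forall i, deg_le 1 (tnth lq i)) ->
  deg_le d (p \mPo lq).
Proof.
move=> pd lq1; rewrite comp_mpolyE big_seq; apply: deg_le_sum => m mp.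
apply: deg_leZ; apply: (@deg_leW (mdeg m)).
  by move/msize_mdeg_lt: mp => /leq_trans /(_ pd).
by rewrite mdegE; apply: deg_le_prod => i; rewrite -[X in deg_le X]mul1n; apply: deg_leX.
Qed.

Definition monoms s := #|{: 'X_{1..n < s.+1}}|.

Definition mon s (i : 'I_(monoms s)) : 'X_{1..n} := enum_val i : 'X_{1..n < s.+1}.

Lemma monoms_le s : (monoms s <= s.+1 ^ n)%N.
Proof.
have bnd (m : 'X_{1..n < s.+1}) i : (bmnm m i < s.+1)%N.
  by apply: leq_ltn_trans (bmdeg m); rewrite mdegE (bigD1 i) //= leq_addr.
pose g (m : 'X_{1..n < s.+1}) : {ffun 'I_n -> 'I_s.+1} :=
  [ffun i => Ordinal (bnd m i)].
have/leq_card : injective g.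
  move=> m1 m2 /ffunP eqg; apply/eqP; rewrite bmeqP; apply/eqP/mnmP => i.
  by have := eqg i; rewrite !ffunE => /(congr1 val).
by rewrite card_ffun !card_ord.
Qed.

Definition coefs s p : 'rV[F]_(monoms s) := \row_i p@_(mon i).


Lemma coefs_expand s p : deg_le s p -> p = \sum_i coefs s p 0 i *: 'X_[mon i].
Proof.
move=> ps; rewrite [LHS](mpolywE ps) (reindex (fun i : 'I_(monoms s) => enum_val i)) /=.
  by apply: eq_bigr => i _; rewrite mxE.
by exists enum_rank => i _; rewrite ?enum_valK ?enum_rankK.
Qed.

End Degree.

(** * Sets of points that are prime up to a given degree *)

Section Points.
Variables (F : fieldType) (n : nat) (T : finType) (v : T -> 'I_n -> F).
Implicit Types (p q : {mpoly F[n]}) (P : {set T}).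

Definition vanish p P := [forall x in P, p.@[v x] == 0].

Lemma vanishP p P : reflect {in P, forall x, p.@[v x] = 0} (vanish p P).
Proof. exact: 'forall_in_eqP. Qed.

Lemma vanishS p P P' : P' \subset P -> vanish p P -> vanish p P'.
Proof. by move=> /subsetP s /vanishP z; apply/vanishP => x /s /z. Qed.

(** The finite counterpart of irreducibility of a variety. The bound on the
degrees is essential: without it, no set with two distinct points would be
prime, as polynomials separate points. *)
Definition prime_upto s P := forall p q, deg_le s p -> deg_le s q ->
  vanish (p * q) P -> vanish p P || vanish q P.

(** The points outside [P] get a zero column, so that the matrices of different
sets have the same size and their kernels can be compared. By [vanish_coefs] the
left kernel is the space of polynomials of degree at most [s] vanishing on
[P]. *)
Definition evalmx s P : 'M[F]_(monoms n s, #|T|) :=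
  \matrix_(i, j) if enum_val j \in P then ('X_[mon i]).@[v (enum_val j)] else 0.

Lemma vanish_coefs s p P :
  deg_le s p -> vanish p P = (coefs s p *m evalmx s P == 0).
Proof.
move=> ps.
have ev x : x \in P -> (coefs s p *m evalmx s P) 0 (enum_rank x) = p.@[v x].
  move=> xP; rewrite mxE [in RHS](coefs_expand ps) raddf_sum /=.
  by apply: eq_bigr => i _; rewrite [evalmx _ _ _ _]mxE enum_rankK xP mevalZ.
apply/vanishP/eqP => [z|z x xP]; last by rewrite -ev // z mxE.
apply/rowP => j; rewrite [RHS]mxE; have [jP|jP] := boolP (enum_val j \in P).
  by rewrite -[j]enum_valK ev ?z.
by rewrite mxE big1 // => i _; rewrite [evalmx _ _ _ _]mxE (negPf jP) mulr0.
Qed.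

(** This rank lies between 0 and the number of monomials; hence it bounds the
number of times a set can be cut down. *)
Lemma kermx_evalmx_lt s p P P' : P' \subset P -> deg_le s p ->
  vanish p P' -> ~~ vanish p P ->
  (\rank (kermx (evalmx s P)) < \rank (kermx (evalmx s P')))%N.
Proof.
move=> /subsetP sP ps; rewrite !(vanish_coefs _ ps) => z nz.
apply: rank_ltmx; rewrite ltmxE; apply/andP; split.
  apply/sub_kermxP/matrixP => i j; rewrite [RHS]mxE.
  have [jP|jP] := boolP (enum_val j \in P').
    have := mulmx_ker (evalmx s P) => /matrixP /(_ i j); rewrite [RHS]mxE => <-.
    by rewrite !mxE; apply: eq_bigr => k _; rewrite ![evalmx _ _ _ _]mxE jP sP.
  by rewrite mxE big1 // => k _; rewrite [evalmx _ _ _ _]mxE (negPf jP) mulr0.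
apply: contra nz => sub; apply/eqP/sub_kermxP; apply: submx_trans sub.
exact/sub_kermxP/eqP.
Qed.

(** If [p * q] vanishes on [P] but neither factor does, the zeros of [p] or those
of [q] make up half of [P]. Halving is repeated, each time with a new polynomial
of degree at most [s] that vanishes, so at most as often as there are
monomials. *)
Lemma prime_refinement s P :
  exists P', [/\ P' \subset P, prime_upto s P' &
                 (#|P| <= #|P'| * 2 ^ monoms n s)%N].
Proof.
pose codim Q := (monoms n s - \rank (kermx (evalmx s Q)))%N.
suff [P' [sP prP bigP]] : exists P', [/\ P' \subset P, prime_upto s P' &
    (#|P| <= #|P'| * 2 ^ codim P)%N].
  exists P'; split=> //; apply: leq_trans bigP _.
  by rewrite leq_mul2l leq_pexp2l ?leq_subr ?orbT.
have [k] := ubnP (codim P); elim: k P => // k IH P ltk.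
have [prP|] := pselect (prime_upto s P).
  by exists P; split; rewrite // leq_pmulr // expn_gt0.
move=> /existsNP [p] /existsNP [q] /not_implyP [ps] /not_implyP [qs].
move=> /not_implyP [pqz] /negP; rewrite negb_or => /andP[pnz qnz].
pose Z (g : {mpoly F[n]}) := [set x in P | g.@[v x] == 0].
have subZ g : Z g \subset P by apply/subsetP => x; rewrite inE => /andP[].
have vanZ g : vanish g (Z g).
  by apply/vanishP => x; rewrite inE => /andP[_ /eqP].
have UZ : P = Z p :|: Z q.
  apply/setP => x; rewrite !inE -andb_orr; case xP: (x \in P) => //=.
  by have /vanishP/(_ x xP)/eqP := pqz; rewrite mevalM mulf_eq0 => ->.
have [g [gs gnz gbig]] : exists g,
    [/\ deg_le s g, ~~ vanish g P & (#|P| <= #|Z g| * 2)%N].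
  have : (#|P| <= #|Z p| + #|Z q|)%N by rewrite {1}UZ leq_card_setU.
  by have [le|le] := leqP #|Z p| #|Z q|; [exists q|exists p]; split=> //; lia.
have ltZ : (codim (Z g) < codim P)%N.
  have lt := kermx_evalmx_lt (subZ g) gs (vanZ g) gnz.
  by rewrite ltn_sub2l // (leq_trans lt) // rank_leq_row.
have [|P' [sP' prP' bigP']] := IH (Z g); first by apply: leq_trans ltZ _.
exists P'; split=> //; first exact: subset_trans sP' (subZ g).
apply: leq_trans gbig _; apply: leq_trans (leq_mul bigP' (leqnn 2)) _.
by rewrite -mulnA -expnSr leq_mul2l leq_pexp2l ?orbT.
Qed.

End Points.

(** * Power products along a chain of prime sets *)

Section Monomials.
Variables (F : fieldType) (n e : nat).
Implicit Types (hs : seq {mpoly F[n]}).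

(** Exponents are nested pairs, along the recursion of the list, so that sums over
them split by the exponent of the head. *)
Fixpoint expo hs : finType :=
  if hs is _ :: hs' then ('I_e * expo hs')%type else unit.

Fixpoint monomial hs : expo hs -> {mpoly F[n]} :=
  if hs is h :: hs' return expo hs -> {mpoly F[n]}
  then fun a => h ^+ a.1 * monomial a.2 else fun=> 1.

Definition lincomb hs (c : expo hs -> F) := \sum_a c a *: monomial a.

Lemma card_expo hs : #|expo hs| = (e ^ size hs)%N.
Proof.
by elim: hs => [|h hs IH] /=; rewrite ?card_unit // card_prod card_ord IH expnS.
Qed.

Lemma deg_le_monomial d hs (a : expo hs) :
  (forall h, h \in hs -> deg_le d h) -> deg_le (d * e * size hs) (monomial a).
Proof.
elim: hs a => [|h hs IH] /= a degs; first exact: deg_le1.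
rewrite mulnS; apply: deg_leM; last first.
  by apply: IH => g ghs; rewrite degs // inE ghs orbT.
apply: (@deg_leW _ _ (d * a.1)); first by rewrite leq_mul2l ltnW ?orbT.
by apply/deg_leX/degs; rewrite mem_head.
Qed.

Lemma deg_le_lincomb d hs (c : expo hs -> F) :
  (forall h, h \in hs -> deg_le d h) -> deg_le (d * e * size hs) (lincomb c).
Proof. by move=> degs; apply: deg_le_sum => a _; apply/deg_leZ/deg_le_monomial. Qed.

Lemma lincomb_cons h hs (c : expo (h :: hs) -> F) :
  lincomb c = \sum_(i < e) h ^+ i * lincomb (hs := hs) (fun a => c (i, a)).
Proof.
under [RHS]eq_bigr do rewrite mulr_sumr.
by rewrite pair_bigA; apply: eq_bigr => -[i a] _ /=; rewrite scalerAr.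
Qed.

(** There are more power products than monomials of the degree that they can
reach. *)
Lemma lincomb_dependent d hs : (forall h, h \in hs -> deg_le d h) ->
  ((d * e * size hs).+1 ^ n < e ^ size hs)%N ->
  exists2 c : expo hs -> F, lincomb c = 0 & exists a, c a != 0.
Proof.
set s := (d * e * size hs)%N => degs lt.
pose A : 'M_(#|expo hs|, monoms n s) :=
  \matrix_i coefs s (monomial (enum_val i)).
have : kermx A != 0.
  rewrite -mxrank_eq0 mxrank_ker subn_eq0 -ltnNge.
  apply: leq_ltn_trans (rank_leq_col _) _.
  by rewrite card_expo; apply: leq_ltn_trans (monoms_le _ _) lt.
move=> /rowV0Pn[u /sub_kermxP uA unz].
exists (fun a => u 0 (enum_rank a)).
  rewrite (coefs_expand (deg_le_lincomb _ degs)) big1 // => j _; rewrite mxE.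
  rewrite /lincomb raddf_sum /=.
  have /rowP/(_ j) := uA; rewrite !mxE => uAj.
  rewrite (_ : \sum_a _ = 0) ?scale0r // -[RHS]uAj.
  rewrite (reindex (fun i : 'I_#|expo hs| => enum_val i)) /=; last first.
    by exists enum_rank => i _; rewrite ?enum_valK ?enum_rankK.
  by apply: eq_bigr => i _; rewrite mcoeffZ !mxE enum_valK.
by have /rV0Pn[i ui] := unz; exists (enum_val i); rewrite enum_valK.
Qed.

Variables (T : finType) (v : T -> 'I_n -> F).

Definition indep hs (P : {set T}) :=
  forall c : expo hs -> F, vanish v (lincomb c) P -> c =1 fun=> 0.

Lemma indep_nil P : P != set0 -> indep [::] P.
Proof.
move=> /set0Pn[x xP] c /vanishP/(_ x xP); rewrite /lincomb (big_pred1 tt); last by case.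
by rewrite mevalZ meval1 mulr1 => c0 [].
Qed.

(** Algebraic independence up to exponent [e] propagates from [P'] to [P]. Write a
relation on [P] as [G_0 + h G_1 + h^2 G_2 + ... = 0], where the [G_i] involve only
[hs]. On [P'], where [h] vanishes, it reads [G_0 = 0], so the coefficients in [G_0]
are zero. Then [h * (G_1 + h G_2 + ...)] vanishes on [P], and [h] may be cancelled
since [P] is prime and [h] does not vanish on it; and so on. *)
Lemma indep_cons s d h hs (P P' : {set T}) :
    (d * e * (size hs).+1 <= s)%N -> deg_le s h ->
    {in h :: hs, forall g, deg_le d g} ->
    prime_upto v s P -> P' \subset P -> vanish v h P' -> ~~ vanish v h P ->
  indep hs P' -> indep (h :: hs) P.
Proof.
move=> les hs_deg degs prP sP hP' hP ind c /= van.
have degs' : {in hs, forall g, deg_le d g}.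
  by move=> g gh; apply: degs; rewrite inE gh orbT.
pose G i := lincomb (hs := hs) (fun a => if insub i is Some j then c (j, a) else 0).
(* [R i] is the relation that is left after cancelling [h] [i] times. *)
pose R i := \sum_(i <= j < e) h ^+ (j - i) * G j.
have Rdeg i : deg_le s (R i).
  apply: deg_leW les _; rewrite mulnS; apply: deg_le_sum => j _.
  have [je|je] := ltnP j e; last first.
    rewrite /G /lincomb big1 ?mulr0 /deg_le ?msize0 // => a _.
    by rewrite insubF ?scale0r // ltnNge je.
  apply: deg_leM (deg_le_lincomb _ degs').
  apply: (@deg_leW _ _ (d * (j - i))); first by rewrite leq_mul2l; apply/orP; right; lia.
  by apply/deg_leX/degs; rewrite mem_head.
have Rrec i : (i < e)%N -> R i = G i + h * R i.+1.
  move=> ie; rewrite /R big_ltn // subnn expr0 mul1r; congr (_ + _).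
  rewrite mulr_sumr !big_nat; apply: eq_bigr => j /andP[ij _].
  by rewrite mulrA -exprS; congr (h ^+ _ * _); lia.
have Gc (i : 'I_e) : vanish v (R i) P -> G i = 0 /\ forall a, c (i, a) = 0.
  move=> Ri.
  have Gi : vanish v (G i) P'.
    apply/vanishP => x xP'; have /vanishP/(_ x xP') := vanishS sP Ri.
    rewrite Rrec // mevalD mevalM.
    by have /vanishP/(_ x xP') -> := hP'; rewrite mul0r addr0.
  have c0 a : c (i, a) = 0 by have := ind _ Gi a; rewrite /= valK.
  by split=> //; rewrite /G /lincomb big1 // => a _; rewrite valK c0 scale0r.
have R0 i : (i <= e)%N -> vanish v (R i) P.
  elim: i => [|i IH] ie.
    rewrite /R big_mkord; move: van; rewrite lincomb_cons.
    congr (vanish v _ P); apply: eq_bigr => i _; rewrite subn0.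
    by congr (_ * _); apply: eq_bigr => a _; rewrite valK.
  have Ri := IH (ltnW ie); have [Gi _] := Gc (Ordinal ie) Ri.
  move: Ri; rewrite Rrec // Gi add0r => hRi.
  by have := prP _ _ hs_deg (Rdeg i.+1) hRi; rewrite (negPf hP).
by case=> i a; case: (Gc i (R0 _ (ltnW (ltn_ord i)))).
Qed.

End Monomials.

Section Chain.
Variables (F : fieldType) (n : nat) (T : finType) (v : T -> 'I_n -> F).
Variables (J : Type) (h : J -> {mpoly F[n]}) (d : nat).
Hypothesis h_deg : forall j, deg_le d (h j).

(** In the limit of large [t]: each [h j] vanishes everywhere or almost nowhere on
[P]. *)
Definition dichotomous t (P : {set T}) := forall j,
  vanish v (h j) P \/ (#|[set x in P | (h j).@[v x] == 0%R]| * t < #|P|)%N.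

(** If [P] is not dichotomous, some [h j] that does not vanish on [P] has a
fraction [1 / t] of [P] as zeros. A prime subset of these zeros takes the place of
[P], and [h j] is put in front of the list found for that subset. *)
Lemma dichotomous_or_indep s e l t (P : {set T}) : (0 < d)%N -> (0 < e)%N ->
    (d * e * l <= s)%N -> prime_upto v s P -> P != set0 -> (0 < t)%N ->
  (exists P' : {set T}, [/\ P' \subset P, dichotomous t P' &
     (#|P| <= #|P'| * (t * 2 ^ monoms n s) ^ l)%N]) \/
  exists hs, [/\ size hs = l, {in hs, forall g, deg_le d g} & indep e v hs P].
Proof.
move=> d0 e0 + + + t0; elim: l P => [|l IH] P les prP P0.
  by right; exists [::]; split=> //; apply: indep_nil.
have K0 : (0 < t * 2 ^ monoms n s)%N by rewrite muln_gt0 t0 expn_gt0.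
have [dP|] := pselect (dichotomous t P).
  by left; exists P; split=> //; rewrite leq_pmulr // expn_gt0 K0.
move=> /existsNP[j] /not_orP[/negP hP /negP]; rewrite -leqNgt.
set Z := [set _ in _ | _] => bigZ.
have [P1 [sP1 prP1 bigP1]] := prime_refinement v s Z.
have sZ : Z \subset P by apply/subsetP => x; rewrite inE => /andP[].
have bigP : (#|P| <= #|P1| * (t * 2 ^ monoms n s))%N.
  by apply: leq_trans bigZ _; rewrite mulnCA mulnC leq_mul2l bigP1 orbT.
have P10 : P1 != set0.
  by rewrite -card_gt0; move: P0; rewrite -card_gt0; move: bigP; case: #|P1|; lia.
have [|[P' [sP' dP' bigP']]|[hs [szhs deghs indhs]]] := IH P1 _ prP1 P10.
- by apply: leq_trans les; rewrite leq_mul2l leqnSn orbT.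
- left; exists P'; split=> //; first exact: subset_trans sP' (subset_trans sP1 sZ).
  by apply: leq_trans bigP _; rewrite expnSr [leqRHS]mulnA leq_mul2r bigP' orbT.
right; exists (h j :: hs); split; rewrite /= ?szhs //.
  by move=> g; rewrite inE => /predU1P[->|/deghs].
apply: (@indep_cons _ _ _ _ _ s d _ _ _ P1); rewrite ?szhs //.
- apply: deg_leW (h_deg j); apply: leq_trans les.
  by rewrite -mulnA leq_pmulr // muln_gt0 e0.
- by move=> g; rewrite inE => /predU1P[->|/deghs].
- exact: subset_trans sP1 sZ.
apply/vanishP => x /(subsetP sP1); by rewrite inE => /andP[_ /eqP].
Qed.

End Chain.

(** Large enough to make [(d * e * l + 1) ^ n < e ^ l] for [l = n + 1]. *)
Definition expo_bound n d := ((d * n.+1).+1 ^ n).+1.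

Definition refinement_cost n d := (2 ^ monoms n (d * expo_bound n d * n.+1))%N.

(** A list of [n + 1] polynomials cannot be independent in the sense of [indep],
by [lincomb_dependent]; so the first alternative of [dichotomous_or_indep] holds. *)
Lemma exists_dichotomous (F : fieldType) (n d t : nat) (T : finType)
    (v : T -> 'I_n -> F) (J : Type) (h : J -> {mpoly F[n]}) :
    (forall j, deg_le d (h j)) -> (0 < n)%N -> (0 < d)%N -> (0 < t)%N -> (0 < #|T|)%N ->
  exists P : {set T}, dichotomous v h t P /\
    (#|T| <= #|P| * (t ^ n.+1 * refinement_cost n d ^ n.+2))%N.
Proof.
move=> hd n0 d0 t0 T0; set e := expo_bound n d.
have [P [_ prP bigP]] := prime_refinement v (d * e * n.+1) setT.
rewrite cardsT in bigP.
have P0 : P != set0.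
  by rewrite -card_gt0; move: bigP; case: #|P|; rewrite ?mul0n; lia.
have e0 : (0 < e)%N by [].
case: (dichotomous_or_indep hd d0 e0 (leqnn _) prP P0 t0) => [[P' [_ dP' bigP']]|].
  exists P'; split=> //; apply: leq_trans bigP _.
  apply: leq_trans (leq_mul bigP' (leqnn _)) _.
  by rewrite expnMn [(refinement_cost n d ^ n.+2)%N]expnSr !mulnA.
move=> [hs [szhs deghs indhs]].
have [|c c0 [a /eqP[]]] := @lincomb_dependent F n e d hs deghs.
  rewrite szhs expnS; apply: (@leq_ltn_trans (e ^ n * (d * n.+1).+1 ^ n)%N).
    by rewrite -expnMn leq_exp2r //; nia.
  by rewrite mulnC ltn_pmul2r ?expn_gt0.
by apply: indhs; rewrite c0; apply/vanishP => x _; rewrite meval0.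
Qed.

(** * Independent sets in sparse digraphs *)

Lemma exists_le_average (T : finType) (A : {set T}) (f : T -> nat) D :
  A != set0 -> (\sum_(x in A) f x <= #|A| * D)%N ->
  exists2 x, x \in A & (f x <= D)%N.
Proof.
move=> A0 le; apply/exists_inP; apply: contraLR le => /exists_inPn big.
rewrite -ltnNge; have /set0Pn[x xA] := A0.
have : (\sum_(y in A) D.+1 <= \sum_(y in A) f y)%N.
  by apply: leq_sum => y /big; rewrite -ltnNge.
rewrite sum_nat_const; move: A0; rewrite -card_gt0; nia.
Qed.

(** The in-degrees have the same average as the out-degrees, so some vertex has at
most [D] neighbours in each direction. It is put into [S], and at most [2 * D + 1]
vertices are discarded. *)
Lemma sparse_digraph_independent (T : finType) (bad : rel T) D (B : {set T}) :
  {in B, forall x, (#|[set y in B | bad x y]| <= D)%N} ->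
  exists S : {set T}, [/\ S \subset B,
    {in S &, forall x y, x != y -> ~~ bad x y} & (#|B| <= #|S| * (2 * D).+1)%N].
Proof.
have [k] := ubnP #|B|; elim: k B => // k IH B ltk out.
have [->|B0] := eqVneq B set0.
  by exists set0; split; rewrite ?cards0 ?sub0set // => x y; rewrite inE.
have [x xB inx] : exists2 x, x \in B & (#|[set y in B | bad y x]| <= D)%N.
  apply: exists_le_average => //.
  have -> : (\sum_(x in B) #|[set y in B | bad y x]| =
             \sum_(y in B) #|[set x in B | bad y x]|)%N.
    transitivity (\sum_(x in B) \sum_(y in B | bad y x) 1)%N.
      apply: eq_bigr => x _; rewrite -sum1_card.
      by apply: eq_bigl => y; rewrite inE.
    rewrite (exchange_big_dep (mem B)) /=; last by move=> x y _ /andP[].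
    apply: eq_bigr => y yB; rewrite -sum1_card.
    by apply: eq_bigl => x; rewrite inE yB.
  by rewrite -sum_nat_const; apply: leq_sum.
pose N := x |: ([set y in B | bad x y] :|: [set y in B | bad y x]).
have NB : N \subset B.
  by apply/subsetP => y; rewrite !inE => /or3P[/eqP->|/andP[]|/andP[]].
have cN : (#|N| <= (2 * D).+1)%N.
  rewrite /N cardsU1; apply: leq_add (leq_b1 _) _.
  apply: leq_trans (leq_card_setU _ _) _.
  by rewrite mul2n -addnn leq_add // out.
have xN : x \in N by rewrite !inE eqxx.
have cB : #|B| = (#|N| + #|B :\: N|)%N.
  by rewrite -[in LHS](cardsID N B) (setIidPr NB).
have [||S [SB indS bigS]] := IH (B :\: N).
- by move: ltk; rewrite cB ltnS; apply: leq_trans; rewrite (cardsD1 x N) xN; lia.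
- move=> y; rewrite inE => /andP[_ yB]; apply: leq_trans (out y yB).
  by apply: subset_leq_card; apply/subsetP => z; rewrite !inE => /andP[/andP[_ ->]].
have far y : y \in S -> [/\ y != x, ~~ bad x y & ~~ bad y x].
  move=> /(subsetP SB); rewrite !inE => /andP[+ yB].
  by rewrite yB !negb_or /= => /and3P[].
exists (x |: S); split.
- by rewrite subUset sub1set xB; apply: subset_trans SB (subsetDl _ _).
- move=> y z; rewrite !inE => /predU1P[->|yS] /predU1P[->|zS].
  + by rewrite eqxx.
  + by case: (far z zS).
  + by case: (far y yS).
  + exact: indS.
rewrite cardsU1; have -> : x \notin S by apply/negP => /far[]; rewrite eqxx.
by rewrite cB mulnDl mul1n leq_add.
Qed.

Lemma pigeonhole (T K : finType) (A : {set T}) (f : T -> K) :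
  (0 < #|K|)%N -> exists k, (#|A| <= #|[set x in A | f x == k]| * #|K|)%N.
Proof.
move=> K0; have [k _ maxk] := eq_bigmax_cond (fun k => #|[set x in A | f x == k]|) K0.
exists k; rewrite -sum1_card (partition_big f predT) //= mulnC -sum_nat_const.
apply: leq_sum => l _; rewrite -maxk.
rewrite (leq_trans _ (leq_bigmax_cond _ (isT : predT l))) //.
by rewrite -sum1_card leq_eqVlt; apply/orP; left; apply/eqP/eq_bigl => x; rewrite inE.
Qed.

(** * Homogeneous sets in algebraic graphs *)

(** [tau] is the set of [i] for which [h (x, i)] vanishes on [P], for the most
frequent type of points [x]. A pair [(x, y)] of points of this type is bad if
[h (x, i)] vanishes at [y] for some [i] outside [tau]; by the dichotomy few pairs
are bad. Badness is not symmetric, but [S] is independent for the digraph, so the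
pattern is [tau] for both orders of each pair. *)
Lemma dichotomous_constant_pattern (F : fieldType) (n m t : nat) (T : finType)
    (v : T -> 'I_n -> F) (h : T * 'I_m -> {mpoly F[n]}) (P : {set T}) :
    (0 < t)%N -> dichotomous v h t P -> (t * 2 ^ m <= #|P|)%N ->
  exists S : {set T}, exists tau : {ffun 'I_m -> bool},
    {in S &, forall x y, x != y -> [ffun i => (h (x, i)).@[v y] == 0] = tau} /\
    (t <= #|S| * (m * 2 ^ m).*2.+1)%N.
Proof.
move=> t0 dP bigP.
pose tau x := [ffun i => vanish v (h (x, i)) P].
have [|k] := @pigeonhole _ {ffun 'I_m -> bool} P tau.
  by rewrite card_ffun card_bool card_ord expn_gt0.
set B := [set x in P | _]; rewrite card_ffun card_bool card_ord => bigB.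
have sB : B \subset P by apply/subsetP => x; rewrite inE => /andP[].
have tauB x i : x \in B -> vanish v (h (x, i)) P = k i.
  by rewrite inE => /andP[_ /eqP <-]; rewrite ffunE.
have tB : (t <= #|B|)%N.
  by have := leq_trans bigP bigB; rewrite leq_pmul2r ?expn_gt0.
pose bad x y := [exists i, ~~ k i && ((h (x, i)).@[v y] == 0)].
have out : {in B, forall x, #|[set y in B | bad x y]| <= (m * #|P|) %/ t}%N.
  move=> x xB; rewrite leq_divRL //.
  pose Z i := [set y in P | (h (x, i)).@[v y] == 0].
  have le : (#|[set y in B | bad x y]| <= \sum_(i | ~~ k i) #|Z i|)%N.
    have -> : (\sum_(i | ~~ k i) #|Z i| =
               \sum_y \sum_(i | ~~ k i) (y \in Z i))%N.
      by rewrite exchange_big; apply: eq_bigr => i _; rewrite -sum1_card big_mkcond.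
    rewrite -sum1_card big_mkcond; apply: leq_sum => y _.
    case: ifP => //; rewrite inE => /andP[yB /existsP[i /andP[ki hi]]].
    by rewrite (bigD1 i) //= inE (subsetP sB) // hi.
  apply: leq_trans (leq_mul le (leqnn t)) _; rewrite big_distrl /=.
  apply: (@leq_trans (\sum_(i < m) #|P|)); last by rewrite sum_nat_const card_ord.
  rewrite big_mkcond; apply: leq_sum => i _; case: ifP => // ki.
  case: (dP (x, i)) => [|/ltnW//]; by rewrite tauB // (negPf ki).
have [S [SB indS bigS]] := sparse_digraph_independent out.
exists S, k; split.
  move=> x y xS yS xy; apply/ffunP => i; rewrite ffunE.
  have [xB yB] := (subsetP SB x xS, subsetP SB y yS).
  case ki: (k i); last first.
    have := indS x y xS yS xy; rewrite negb_exists => /forallP/(_ i).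
    by rewrite ki => /negPf.
  have := tauB x i xB; rewrite ki => /vanishP/(_ y) ->; rewrite ?eqxx //.
  exact: (subsetP sB).
rewrite -(leq_pmul2r (leq_trans t0 tB)) -mulnA.
apply: (@leq_trans (#|B| * t)); first by rewrite mulnC.
apply: leq_trans (leq_mul bigS (leqnn t)) _; rewrite -mulnA leq_mul2l.
have := leq_trunc_div (m * #|P|) t.
have : (m * #|P| <= m * 2 ^ m * #|B|)%N.
  by rewrite -mulnA leq_mul2l [(2 ^ m * _)%N]mulnC bigB orbT.
move: (m * #|P|)%N (m * 2 ^ m)%N => a b ab le; apply/orP; right.
rewrite mulSn mulSn -mul2n; nia.
Qed.

Definition slice (F : fieldType) (n : nat) (f : {mpoly F[n + n]})
    (x : 'rV[F]_n) : {mpoly F[n]} :=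
  f \mPo [tuple match split k with inl j => (x 0 j)%:MP | inr j => 'X_j end
         | k < n + n].

Lemma meval_slice (F : fieldType) (n : nat) (f : {mpoly F[n + n]})
    (x y : 'rV[F]_n) : (slice f x).@[y 0] = eval2 f x y.
Proof.
rewrite comp_mpoly_meval; apply: meval_eq => k; rewrite tnth_mktuple mxE.
by case: split => j; rewrite ?mevalC ?mevalXU.
Qed.

Lemma deg_le_slice (F : fieldType) (n d : nat) (f : {mpoly F[n + n]})
    (x : 'rV[F]_n) : (msize f <= d.+1)%N -> deg_le d (slice f x).
Proof.
move=> fd; apply: deg_le_comp => // k; rewrite tnth_mktuple /deg_le.
by case: split => j; rewrite ?msizeX ?mdeg1 ?msizeC //; case: eqP.
Qed.

(** The size required of the graph makes the dichotomous set at least [t * 2 ^ m]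
large, so that the points of the most frequent type are at least [t] many. *)
Lemma algebraic_graph_homogeneous (F : fieldType) (n d m t : nat)
    (G : graph 'rV[F]_n) :
    (0 < n)%N -> (0 < d)%N -> (0 < t)%N -> algebraic_graph d m G ->
    ((2 ^ m * refinement_cost n d * t) ^ n.+2 <= #|` vset G|)%N ->
  exists S : {fset 'rV[F]_n}, (clique G S \/ independent G S) /\
    (t <= #|` S| * (m * 2 ^ m).*2.+1)%N.
Proof.
move=> n0 d0 t0 [f [phi [fd adjE]]] bigV.
pose T : finType := vset G.
pose v (x : T) : 'I_n -> F := val x 0.
pose h (xi : T * 'I_m) := slice (f xi.2) (val xi.1).
have hd xi : deg_le d (h xi) by apply/deg_le_slice/fd.
have L0 : (0 < refinement_cost n d)%N by rewrite expn_gt0.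
have cT : #|T| = #|` vset G| by rewrite -cardfE.
have T0 : (0 < #|T|)%N.
  by rewrite cT; apply: leq_trans bigV; rewrite expn_gt0 !muln_gt0 expn_gt0 L0 t0.
have [P [dP bigP]] := exists_dichotomous v hd n0 d0 t0 T0.
have [|S [tau [pat bigS]]] := dichotomous_constant_pattern t0 dP.
  have /leq_trans/(_ bigP) : (2 ^ m * (refinement_cost n d * t) ^ n.+2 <= #|T|)%N.
    rewrite cT; apply: leq_trans bigV; rewrite -mulnA [leqRHS]expnMn leq_mul2r.
    by rewrite -[X in (X <= _)%N]expn1 leq_pexp2l ?expn_gt0 // orbT.
  rewrite expnMn [(t ^ n.+2)%N]expnS => le.
  rewrite -(@leq_pmul2r (t ^ n.+1 * refinement_cost n d ^ n.+2)); last first.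
    by rewrite muln_gt0 expn_gt0 t0 expn_gt0 L0.
  by apply: leq_trans le; rewrite leq_eqVlt; apply/orP; left; apply/eqP; ring.
exists [fset val x | x in S]%fset; split; last first.
  by rewrite (card_imfset _ _ val_inj) /= -cardE.
have sub : ([fset val x | x in S] `<=` vset G)%fset.
  by apply/fsubsetP => _ /imfsetP[x _ ->]; apply: valP.
have adjS : {in [fset val x | x in S]%fset &, forall x y,
    x != y -> adj G x y = phi tau}.
  move=> _ _ /imfsetP[x xS ->] /imfsetP[y yS ->] xy.
  rewrite adjE ?(valP x, valP y) // -(pat x y xS yS) //.
  by congr phi; apply/ffunP => i; rewrite !ffunE -meval_slice.
case tauE: (phi tau); [left|right]; split=> // x y xS yS xy.
  by rewrite adjS.
by rewrite adjS // tauE.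
Qed.

(** * Comparison of the exponents *)
Lemma min_factor_ge (R : realType) (n d : nat) :
  (0 < d)%N -> ln 2 <= min_factor R n d.
Proof.
move=> d0.
have ln2_1 : ln 2 <= 1 :> R by rewrite (_ : 2 = 1 + 1) ?le_ln1Dx //; lra.
have le1d : ln 2 <= d%:R :> R by rewrite (le_trans ln2_1) // ler1n.
rewrite /min_factor; case: ifP => // /andP[n1 d1]; rewrite le_min le1d /=.
have lnn : 0 < ln n%:R :> R by rewrite ln_gt0 // ltr1n.
rewrite ler_pdivlMr //; apply: (@le_trans _ _ (ln d%:R * n%:R)); last by rewrite mulrC.
apply: ler_pM; rewrite ?ln_ge0 ?ler1n ?(ltnW n1) //.
  by rewrite ler_ln ?posrE ?ltr0n ?ler_nat.
by rewrite ltW // ln_sublinear // ltr0n ltnW.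
Qed.

Lemma gamma_ge (R : realType) (n d m : nat) : (0 < n)%N -> (0 < d)%N ->
  (0 < m)%N -> n.+2%:R <= gamma (3 / ln 2 : R) n d m.
Proof.
move=> n0 d0 m0; have l2 : 0 < ln 2 :> R by rewrite ln_gt0 // ltr1n.
have mf := min_factor_ge R n d0.
have n1 : 1 <= n%:R :> R by rewrite ler1n.
have m1 : 1 <= m%:R :> R by rewrite ler1n.
apply: (@le_trans _ _ (3 / ln 2 * n%:R * 1 * ln 2)).
  by rewrite mulr1 mulrAC divfK ?gt_eqF // -natrM ler_nat; lia.
have c0 : 0 <= 3 / ln 2 * n%:R :> R by rewrite !mulr_ge0 ?invr_ge0 // ltW.
by rewrite /gamma ler_pM ?ler_wpM2l ?mulr1 // ltW.
Qed.

Lemma powR_inv_natmul_le (R : realType) (g : R) (k N b : nat) : (0 < k)%N ->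
  (0 < N)%N -> k%:R <= g -> (N <= b ^ k)%N -> N%:R `^ g^-1 <= b%:R.
Proof.
move=> k0 N0 kg Nb; have k0' : 0 < k%:R :> R by rewrite ltr0n.
apply: (@le_trans _ _ (N%:R `^ k%:R^-1)).
  by rewrite ler_powR ?ler1n // lef_pV2 ?posrE // (lt_le_trans k0').
apply: (@le_trans _ _ ((b ^ k)%:R `^ k%:R^-1)).
  by apply: ge0_ler_powR; rewrite ?nnegrE ?invr_ge0 ?ler0n ?ler_nat.
by rewrite natrX -powR_mulrn // -powRrM mulfV ?gt_eqF // powRr1.
Qed.

Theorem theorem1p1 (R : realType) :
  exists2 c : R, 0 < c &
  forall n d m : nat, (0 < n)%N -> (0 < d)%N -> (0 < m)%N ->
  exists2 c' : R, 0 < c' &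
  forall (N : nat) (F : fieldType) (G : graph 'rV[F]_n),
    (0 < N)%N -> #|` vset G| = N -> algebraic_graph d m G ->
  exists S : {fset 'rV[F]_n},
    (clique G S \/ independent G S) /\
    c' * N%:R `^ (gamma c n d m)^-1 <= #|` S|%:R.
Proof.
exists (3 / ln 2); first by rewrite divr_gt0 // ln_gt0 // ltr1n.
move=> n d m n0 d0 m0.
(* [A] and [C] are the constants of [algebraic_graph_homogeneous]; [t] will be the
   largest integer to which that lemma applies, so [N] is less than
   [(A * (t + 1)) ^ (n + 2)]. *)
pose A := (2 ^ m * refinement_cost n d)%N; pose C := ((m * 2 ^ m).*2.+1)%N.
have A0 : (0 < A)%N by rewrite muln_gt0 !expn_gt0.
have AC0 : 0 < (A * C.+1)%:R :> R by rewrite ltr0n muln_gt0 A0.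
exists ((A * C.+1)%:R^-1); first by rewrite invr_gt0.
move=> N F G N0 cG algG.
have ex0 : exists t, ((A * t) ^ n.+2 <= N)%N by exists 0%N; rewrite muln0 exp0n.
have bnd t : ((A * t) ^ n.+2 <= N)%N -> (t <= N)%N.
  apply: leq_trans; have [->|t0] := posnP t; first by [].
  apply: leq_trans (leq_pmull t A0) _.
  by rewrite -[X in (X <= _)%N]expn1 leq_pexp2l // muln_gt0 A0.
case: (ex_maxnP ex0 bnd) => t tN maxt.
have [S [homS tS S0]] : exists S : {fset 'rV[F]_n},
    [/\ clique G S \/ independent G S, (t <= #|` S| * C)%N & (0 < #|` S|)%N].
  (* For very small [N] the constant makes any nonempty set large enough. *)
  have [t0|t0] := posnP t.
    have /fset0Pn[x xG] : vset G != fset0 by rewrite -cardfs_gt0 cG.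
    exists [fset x]%fset; rewrite cardfs1 t0; split=> //.
    left; split; first by rewrite fsub1set.
    by move=> y z; rewrite !inE => /eqP-> /eqP->; rewrite eqxx.
  have [|S [homS tS]] := algebraic_graph_homogeneous n0 d0 t0 algG.
    by rewrite cG.
  exists S; split=> //; move: t0; apply: contraTT.
  by rewrite -!leqNgt leqn0 => /eqP S0; move: tS; rewrite S0 mul0n leqn0.
exists S; split=> //; rewrite mulrC ler_pdivrMr // -natrM.
apply: (@powR_inv_natmul_le _ _ n.+2) => //; first exact: gamma_ge.
apply: (@leq_trans ((A * t.+1) ^ n.+2)).
  by rewrite leqNgt; apply/negP => /ltnW /maxt; rewrite ltnn.
by rewrite leq_exp2r //; nia.
Qed.
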